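(* For a prime power $q$, there exist infinitely many integers $n$ such that a twisted Latin Square graph $TLS(q,n)$ exists. The graph $TLS(q,n)$ is a co-edge-regular graph with level $3$ and is cospectral with the $q$-clique extension of each Latin Square graph $LS_{q+1}(qn)$.
   Context: Write $[N]=\{1,\dots,N\}$. Graphs are finite and simple; cospectral means having the same adjacency spectrum (with multiplicities). For adjacent $x,y$, $\lambda(x,y)$ is the number of common neighbours. A regular graph is co-edge-regular with parameter $\mu$ if any two distinct non-adjacent vertices have exactly $\mu$ common neighbours; it has level $t$ if $\#\{\lambda(x,y)\mid x,y\text{ adjacent}\}=t$. Latin Square graphs: an $OA(N,m)$ is an $m\times N^2$ array with entries in $[N]$ such that for any two distinct rows $r_i,r_j$ the pairs $(r_i(\ell),r_j(\ell))$, $\ell\in[N^2]$, take $N^2$ different values. Given an $OA(N,m)$ with columns $c_1,\dots,c_{N^2}$, the graph $LS_m(N)$ has the columns as vertices, with $c_i\sim c_j$ ($i\neq j$) iff $c_i(\ell)=c_j(\ell)$ for some $\ell$. The $s$-clique extension of a graph $G$ replaces each vertex $x$ by an $s$-clique, vertices from the cliques of distinct $x,y$ being adjacent iff $x\sim y$ in $G$. Twisted Latin Square graphs: a group-divisible orthogonal array $GOA(n,s,t)$ is an $st\times n^2$ array with entries in $[n]$, whose rows are partitioned into $t$ groups of $s$ rows each (repeated rows within a group are allowed), such that for any two rows $r,r'$ from different groups the pairs $(r(\ell),r'(\ell))$, $\ell\in[n^2]$, take $n^2$ different values. Let $q$ be a prime power and $n$ a positive integer such that a $GOA(n,q,q+1)$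 exists; let $\mathcal O$ be one, with groups $G_1,\dots,G_{q+1}$, and let the rows of $G_i$ be $r^i_1,\dots,r^i_q$. A plane is an affine plane in $\mathbb F_q^3$; a parallel class is a set of $q$ mutually disjoint planes. Let $\mathcal S_i=\{P^i_1,\dots,P^i_q\}$ ($i\in[q+1]$) be parallel classes in $\mathbb F_q^3$ such that (1) $|P\cap Q|=q$ for $P\in\mathcal S_i,Q\in\mathcal S_j$, $i\ne j$; (2) $|P\cap Q\cap R|=1$ for $P\in\mathcal S_h,Q\in\mathcal S_i,R\in\mathcal S_j$, $h<i<j$ (such classes exist for every prime power $q$). The twisted Latin Square graph $TLS(q,n)$ (with respect to $\mathcal O$) has vertex set $\mathbb F_q^3\times[n^2]$; two distinct vertices $(\mathbf x,i),(\mathbf y,j)$ are adjacent iff $i=j$ or there exist $p\in[q+1],\ell\in[q]$ with $\mathbf x,\mathbf y\in P^p_\ell$ and $r^p_\ell(i)=r^p_\ell(j)$.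
   Formalization: The level-3 claim is stated only for n > 1, since TLS(q,1) is the complete graph on q^3 vertices and has level 1; co-edge-regularity and cospectrality are stated for all n ≥ 1. *)

(* Defs.v *)
From HB Require Import structures.
From mathcomp Require Import all_boot all_order all_algebra all_field.

Set Implicit Arguments.
Unset Strict Implicit.
Unset Printing Implicit Defensive.

Import GRing.Theory.

Definition is_prime_power (q : nat) : Prop :=
  exists p k : nat, [/\ prime p, 0 < k & q = p ^ k].

Record sgraph := SGraph {
  vertex :> finType;
  adj : rel vertex;
  adj_sym : symmetric adj;
  adj_irr : irreflexive adj
}.

Definition common_nbrs (G : sgraph) (x y : G) : nat :=
  #|[set z : G | adj x z && adj y z]|.

Definition regular (G : sgraph) : Prop :=
  exists k : nat, forall x : G, #|[set y : G | adj x y]| = k.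

Definition co_edge_regular (G : sgraph) (mu : nat) : Prop :=
  regular G /\
  forall x y : G, x != y -> ~~ adj x y -> common_nbrs x y = mu.

Definition level (G : sgraph) : nat :=
  size (undup [seq common_nbrs e.1 e.2 | e in [pred e : G * G | adj e.1 e.2]]).

(* The eigenvalues of a 0/1 matrix are algebraic numbers, so that working over
   algC loses none of them. Adjacency matrices being real symmetric, the
   algebraic multiplicities coincide with the dimensions of the eigenspaces. *)
Definition adjmx (G : sgraph) : 'M[algC]_#|G| :=
  \matrix_(i, j) (adj (enum_val i : G) (enum_val j))%:R%R.

Definition eigenvalue_mult (G : sgraph) (a : algC) : nat :=
  \rank (eigenspace (adjmx G) a).

Definition cospectral (G H : sgraph) : Prop :=
  forall a : algC, eigenvalue_mult G a = eigenvalue_mult H a.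

Section CliqueExtension.
Variables (s : nat) (G : sgraph).

Definition clique_ext_adj : rel (G * 'I_s) :=
  fun u v => (u != v) && ((u.1 == v.1) || adj u.1 v.1).

Lemma clique_ext_sym : symmetric clique_ext_adj.
Proof.
by move=> u v; rewrite /clique_ext_adj eq_sym (eq_sym u.1) adj_sym.
Qed.

Lemma clique_ext_irr : irreflexive clique_ext_adj.
Proof. by move=> u; rewrite /clique_ext_adj eqxx. Qed.

Definition clique_ext : sgraph := SGraph clique_ext_sym clique_ext_irr.

End CliqueExtension.

Definition is_OA (N m : nat) (C : 'M['I_N]_(m, N ^ 2)) : Prop :=
  forall r r' : 'I_m, r != r' -> injective (fun c => (C r c, C r' c)).

Section LatinSquareGraph.
Variables (N m : nat) (C : 'M['I_N]_(m, N ^ 2)).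

Definition LS_adj : rel 'I_(N ^ 2) :=
  fun i j => (i != j) && [exists l, C l i == C l j].

Lemma LS_sym : symmetric LS_adj.
Proof.
move=> i j; rewrite /LS_adj eq_sym; congr (_ && _).
by apply: eq_existsb => l; rewrite eq_sym.
Qed.

Lemma LS_irr : irreflexive LS_adj.
Proof. by move=> i; rewrite /LS_adj eqxx. Qed.

Definition LS : sgraph := SGraph LS_sym LS_irr.

End LatinSquareGraph.

(* The rows are presented group by group: row l of the block O g is the l-th
   row of the group g. *)
Definition is_GOA (n s t : nat) (O : 'I_t -> 'M['I_n]_(s, n ^ 2)) : Prop :=
  forall (g g' : 'I_t) (l l' : 'I_s), g != g' ->
    injective (fun c => (O g l c, O g' l' c)).

Definition is_plane (F : finFieldType) (P : {set 'rV[F]_3}) : Prop :=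
  exists (x0 : 'rV[F]_3) (U : {vspace 'rV[F]_3}),
    \dim U = 2 /\ P = [set x | (x - x0)%R \in U].

Definition is_parallel_class (F : finFieldType) (q : nat)
    (S : 'I_q -> {set 'rV[F]_3}) : Prop :=
  (forall l, is_plane (S l)) /\
  (forall l l', l != l' -> [disjoint S l & S l']).

Definition is_TLS_classes (F : finFieldType) (q : nat)
    (S : 'I_q.+1 -> 'I_q -> {set 'rV[F]_3}) : Prop :=
  [/\ forall i, is_parallel_class (S i),
      forall i j l l', i != j -> #|S i l :&: S j l'| = q
    & forall (h i j : 'I_q.+1) l l' l'', h < i -> i < j ->
        #|S h l :&: S i l' :&: S j l''| = 1].

Section TwistedLatinSquareGraph.
Variables (F : finFieldType) (q n : nat).
Variables (O : 'I_q.+1 -> 'M['I_n]_(q, n ^ 2)).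
Variables (S : 'I_q.+1 -> 'I_q -> {set 'rV[F]_3}).

Definition TLS_adj : rel ('rV[F]_3 * 'I_(n ^ 2)) :=
  fun u v => (u != v) &&
    ((u.2 == v.2) ||
     [exists p, exists l,
        [&& u.1 \in S p l, v.1 \in S p l & O p l u.2 == O p l v.2]]).

Lemma TLS_sym : symmetric TLS_adj.
Proof.
move=> u v; rewrite /TLS_adj eq_sym (eq_sym u.2); congr (_ && (_ || _)).
apply: eq_existsb => p; apply: eq_existsb => l.
by rewrite andbCA (eq_sym (O p l u.2)).
Qed.

Lemma TLS_irr : irreflexive TLS_adj.
Proof. by move=> u; rewrite /TLS_adj eqxx. Qed.

Definition TLS : sgraph := SGraph TLS_sym TLS_irr.

End TwistedLatinSquareGraph.

Definition is_TLS (F : finFieldType) (q n : nat) (G : sgraph) : Prop :=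
  exists (O : 'I_q.+1 -> 'M['I_n]_(q, n ^ 2))
         (S : 'I_q.+1 -> 'I_q -> {set 'rV[F]_3}),
    [/\ 0 < n, is_GOA O, is_TLS_classes S & G = TLS O S].

(* Main.v *)
(* Let A be the adjacency matrix of TLS(q, n), or of the q-clique extension of
   a graph LS_{q+1}(qn). In both cases A + I = P - D, where P is the sum of the
   q + 1 partition matrices "same p-th label" and D is a correction inside the
   blocks of vertices with the same array column: D = q (I (x) J) for the clique
   extension, and D = I (x) (K - J) for TLS(q, n), where K x y is the number of
   parallel classes having a plane through both x and y. Any two labels
   determine q vertices, whence
     P^2 = q^2 n P + q^2 (q + 1) J,  PD = DP = q^2 P,  D^2 = q^2 D,  DJ = q^2 J,
   with tr P = (q + 1) v and tr D = q v. So J / v, P / (q^2 n) - q J / v, D / q^2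
   and I form a chain of commuting idempotents, and the traces of their
   differences are the eigenvalue multiplicities, the same for both graphs.
   The same relations give the number of common neighbours of u != v as
     q^2 (q + 1) + q^2 (n - 1) D u v + (q^2 (n - 2) - 2) A u v.
   In TLS(q, n), D vanishes on non-adjacent pairs and takes the values -1, 0, 1 on
   adjacent ones, as K takes the values 0, 1, 2 off the diagonal; that each of
   these occurs follows from the first two moments of K. *)
Require Import Defs.
From HB Require Import structures.
From mathcomp Require Import all_boot all_order all_algebra all_field.
From mathcomp Require Import ring zify.

Set Implicit Arguments.
Unset Strict Implicit.
Unset Printing Implicit Defensive.

Import Order.TTheory GRing.Theory Num.Theory.
Local Open Scope ring_scope.

(** * Eigenspace ranks as traces of orthogonal idempotents *)

Section Idempotents.
Variables (F : fieldType) (n : nat).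
Implicit Types E : 'M[F]_n.

(** In a full-rank factorization E = C R, cancelling C on the left and R on the right of E E = E
    gives R C = 1, of size the rank; the trace is cyclic. *)
Lemma rank_idempotent E : E *m E = E -> (\rank E)%:R = \tr E.
Proof.
move=> EE; have [L LK] := row_fullP (col_base_full E).
have [R RK] := row_freeP (row_base_free E).
have rcK : row_base E *m col_base E = 1%:M.
  have : col_base E *m row_base E *m (col_base E *m row_base E)
         = col_base E *m row_base E by rewrite !mulmx_base.
  move: (col_base E) (row_base E) LK RK => C D LK RK.
  move=> /(congr1 (fun X => L *m X *m R)).
  by rewrite !mulmxA LK mul1mx -mulmxA RK mulmx1.
by rewrite -{2}(mulmx_base E) mxtrace_mulC rcK mxtrace1.
Qed.

(** The [theta i] may coincide: the eigenspace is the row space of the sum Z of all [E i] with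
    [theta i = a], itself idempotent. *)
Lemma rank_eigenspace_spectral (I : finType) (E : I -> 'M[F]_n) (theta : I -> F) a :
  (forall i j, E i *m E j = if i == j then E i else 0) ->
  \sum_i E i = 1%:M ->
  (\rank (eigenspace (\sum_i theta i *: E i) a))%:R
    = \sum_(i | theta i == a) \tr (E i).
Proof.
move=> EE E1; pose Z := \sum_(i | theta i == a) E i.
have sumE (P Q : pred I) (x y : I -> F) :
    (\sum_(i | P i) x i *: E i) *m (\sum_(i | Q i) y i *: E i)
      = \sum_(i | P i && Q i) (x i * y i) *: E i.
  rewrite mulmx_suml big_mkcondr /=; apply: eq_bigr => i _.
  rewrite mulmx_sumr; under eq_bigr => j _.
    rewrite -scalemxAl -scalemxAr EE eq_sym scalerA (fun_if (fun u => _ *: u)) scaler0; over.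
  case: ifP => Qi.
    by rewrite -big_mkcondr (big_pred1 i) // => j /=; case: eqP => [->|]; rewrite ?Qi ?andbF.
  rewrite -big_mkcondr big1 // => j /andP[Qj /eqP ji].
  by rewrite -ji Qj in Qi.
have ZE : Z = \sum_(i | theta i == a) 1 *: E i.
  by apply: eq_bigr => i _; rewrite scale1r.
have XE : \sum_i theta i *: E i - a%:M = \sum_i (theta i - a) *: E i.
  under [in RHS]eq_bigr do rewrite scalerBl.
  by rewrite sumrB -scaler_sumr E1 scalemx1.
suff eZ : (eigenspace (\sum_i theta i *: E i) a :=: Z)%MS.
  rewrite eZ rank_idempotent; first by rewrite raddf_sum.
  by rewrite ZE sumE; apply: eq_big => i; rewrite ?andbb // mulr1.
apply/eqmxP/andP; split; last first.
  apply/sub_kermxP; rewrite XE ZE sumE big1 // => i; rewrite andbT => /eqP->.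
  by rewrite subrr mulr0 scale0r.
set K := eigenspace _ _.
have KX : K *m (\sum_i (theta i - a) *: E i) = 0.
  by rewrite -XE; exact: mulmx_ker.
have K0 : K *m (1%:M - Z) = 0.
  (* Inverting [theta i - a] wherever it is nonzero makes 1 - Z a right multiple of the shifted
     matrix, so it kills K. *)
  suff -> : 1%:M - Z = (\sum_i (theta i - a) *: E i) *m
              \sum_(i | theta i != a) (theta i - a)^-1 *: E i.
    by rewrite mulmxA KX mul0mx.
  rewrite sumE -E1 (bigID (fun i => theta i == a)) /= addrC addrK.
  by apply: eq_bigr => i ti; rewrite divff ?scale1r // subr_eq0.
move/eqP: K0; rewrite mulmxBr mulmx1 subr_eq0 => /eqP ->.
exact: submxMl.
Qed.

(* Differences of consecutive members of a chain of idempotents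
   F0 <= F1 <= F2 <= 1 are orthogonal idempotents. *)
Lemma rank_eigenspace_chain (F0 F1 F2 : 'M[F]_n) (x y z w a : F) :
  F0 *m F0 = F0 -> F1 *m F1 = F1 -> F2 *m F2 = F2 ->
  F0 *m F1 = F0 -> F1 *m F0 = F0 -> F0 *m F2 = F0 -> F2 *m F0 = F0 ->
  F1 *m F2 = F1 -> F2 *m F1 = F1 ->
  (\rank (eigenspace (x *: F0 + y *: F1 + z *: F2 + w%:M) a))%:R
  = \tr F0 *+ (x + y + z + w == a) + (\tr F1 - \tr F0) *+ (y + z + w == a)
    + (\tr F2 - \tr F1) *+ (z + w == a) + (n%:R - \tr F2) *+ (w == a).
Proof.
move=> h00 h11 h22 h01 h10 h02 h20 h12 h21.
pose E (i : 'I_4) := nth 0 [:: F0; F1 - F0; F2 - F1; 1%:M - F2] i.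
pose t (i : 'I_4) := nth 0 [:: x + y + z + w; y + z + w; z + w; w] i.
have -> : x *: F0 + y *: F1 + z *: F2 + w%:M = \sum_i t i *: E i.
  rewrite !big_ord_recl big_ord0 /= /t /E /=.
  rewrite !scalerBr !scalerDl scalemx1 addr0.
  apply/matrixP => i j; rewrite !mxE; ring.
rewrite rank_eigenspace_spectral; last 2 first.
- have H := (h00, h01, h02, h10, h11, h12, h20, h21, h22, mulmxBl, mulmxBr, mulmx1, mul1mx).
  move=> [[|[|[|[|i]]]] hi] // [[|[|[|[|j]]]] hj] //; rewrite /E /= ?H -?val_eqE /=;
  by apply/matrixP => k l; rewrite !mxE; ring.
- by rewrite !big_ord_recl big_ord0 /= /E /=; apply/matrixP => k l; rewrite !mxE; ring.
rewrite big_mkcond /= !big_ord_recl big_ord0 /= /t /E /= !raddfB /= mxtrace1.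
by do 4 case: (_ == a); rewrite /= ?mulr0n ?mulr1n ?addr0 ?add0r ?addrA.
Qed.

End Idempotents.

(** * The spectrum of P - D - I from the relations of P, D and J *)

Section TwoBlockAlgebra.
Variables (R : numFieldType) (v q n : nat) (P D : 'M[R]_v).
Let J : 'M[R]_v := const_mx 1.
Hypotheses (q_gt0 : (0 < q)%N) (n_gt0 : (0 < n)%N) (vE : v = (q ^ 3 * n ^ 2)%N).
Hypotheses (Psym : P^T = P) (Dsym : D^T = D).
Hypothesis PP : P *m P = (q%:R ^+ 2 * n%:R) *: P + (q%:R ^+ 2 * q.+1%:R) *: J.
Hypothesis PD : P *m D = q%:R ^+ 2 *: P.
Hypothesis DD : D *m D = q%:R ^+ 2 *: D.
Hypothesis PJ : P *m J = (q.+1%:R * (q%:R ^+ 2 * n%:R)) *: J.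
Hypothesis DJ : D *m J = q%:R ^+ 2 *: J.
Hypotheses (trP : \tr P = (q.+1 * v)%:R) (trD : \tr D = (q * v)%:R).

(** Boolean multiples add up correctly even when eigenvalues coincide, as the second and fourth do
    for n = 1. *)
Lemma rank_eigenspace_two_block a :
  (\rank (eigenspace (P - D - 1%:M) a))%:R =
  1 *+ (q%:R ^+ 3 * n%:R + q%:R ^+ 2 * n%:R - q%:R ^+ 2 - 1 == a)
  + (q.+1%:R * q%:R * n%:R - q%:R - 1) *+ (q%:R ^+ 2 * n%:R - q%:R ^+ 2 - 1 == a)
  + (q%:R ^+ 2 * n%:R ^+ 2 - q.+1%:R * q%:R * n%:R + q%:R) *+ (- q%:R ^+ 2 - 1 == a)
  + (q%:R ^+ 3 * n%:R ^+ 2 - q%:R ^+ 2 * n%:R ^+ 2) *+ (- 1 == a) :> R.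
Proof.
have q0 : q%:R != 0 :> R by rewrite pnatr_eq0 -lt0n.
have n0 : n%:R != 0 :> R by rewrite pnatr_eq0 -lt0n.
have vR : v%:R = q%:R ^+ 3 * n%:R ^+ 2 :> R by rewrite vE natrM !natrX.
have v0 : v%:R != 0 :> R by rewrite vR mulf_neq0 // expf_neq0.
have SR : q.+1%:R = q%:R + 1 :> R by rewrite -addn1 natrD.
have Jsym : J^T = J by rewrite trmx_const.
have JJ : J *m J = v%:R *: J.
  apply/matrixP => i j; rewrite !mxE; under eq_bigr do rewrite !mxE mulr1.
  by rewrite sumr_const card_ord mulr1.
have trJ : \tr J = v%:R.
  by rewrite /mxtrace; under eq_bigr do rewrite mxE; rewrite sumr_const card_ord.
have DP : D *m P = q%:R ^+ 2 *: P by rewrite -[LHS]trmxK trmx_mul Psym Dsym PD linearZ /= Psym.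
have JP : J *m P = (q.+1%:R * (q%:R ^+ 2 * n%:R)) *: J.
  by rewrite -[LHS]trmxK trmx_mul Psym Jsym PJ linearZ /= Jsym.
have JD : J *m D = q%:R ^+ 2 *: J by rewrite -[LHS]trmxK trmx_mul Dsym Jsym DJ linearZ /= Jsym.
pose F0 : 'M[R]_v := v%:R^-1 *: J.
(* On the all-ones vector P / (q^2 n) has eigenvalue q + 1; subtracting q F0 lowers it to 1, so that
   F0 lies below F1. *)
pose F1 : 'M[R]_v := (q%:R ^+ 2 * n%:R)^-1 *: P - q%:R *: F0.
pose F2 : 'M[R]_v := q%:R ^- 2 *: D.
have -> : P - D - 1%:M = (q%:R ^+ 3 * n%:R) *: F0 + (q%:R ^+ 2 * n%:R) *: F1
                         + (- q%:R ^+ 2) *: F2 + (-1)%:M.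
  apply/matrixP => i j; rewrite /F1 /F0 /F2 !mxE vR mulNrn; field.
  by rewrite q0 n0.
have tr0 : \tr F0 = 1 by rewrite linearZ /= trJ mulVf.
have tr1 : \tr F1 = q.+1%:R * q%:R * n%:R - q%:R.
  rewrite linearB 2!linearZ /= tr0 trP natrM vR SR; field.
  by rewrite q0 n0.
have tr2 : \tr F2 = q%:R ^+ 2 * n%:R ^+ 2.
  by rewrite linearZ /= trD natrM vR; field.
rewrite rank_eigenspace_chain ?tr0 ?tr1 ?tr2.
  rewrite vR; congr (_ *+ nat_of_bool (_ == a) + _ *+ nat_of_bool (_ == a) + _ *+ _ + _ *+ _); ring.
all: rewrite /F1 /F0 /F2 ?(mulmxBl, mulmxBr) -?(scalemxAl, scalemxAr).
all: rewrite ?(PP, PD, DP, DD, PJ, JP, DJ, JD, JJ).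
all: by apply/matrixP => i j; rewrite !mxE ?vR ?SR; field; rewrite ?q0 ?n0.
Qed.

End TwoBlockAlgebra.

(** * Matrices indexed by a finite type *)

Section FunctionMatrix.
Variables (R : pzRingType) (T : finType).
Implicit Types f g : T -> T -> R.

Definition fun_mx f : 'M[R]_#|T| := \matrix_(i, j) f (enum_val i) (enum_val j).

Lemma fun_mxM f g : fun_mx f *m fun_mx g = fun_mx (fun x y => \sum_z f x z * g z y).
Proof.
apply/matrixP => i j; rewrite !mxE [RHS](reindex _ (onW_bij _ (@enum_val_bij T))) /=.
by apply: eq_bigr => k _; rewrite !mxE.
Qed.

Lemma mxtrace_fun_mx f : \tr (fun_mx f) = \sum_x f x x.
Proof.
rewrite /mxtrace [RHS](reindex _ (onW_bij _ (@enum_val_bij T))) /=.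
by apply: eq_bigr => k _; rewrite !mxE.
Qed.

End FunctionMatrix.

(** * Nets and the number of classes in which two points agree *)

Section Net.
Variables (I T L : finType) (f : I -> T -> L) (k : nat).

(** An orthogonal array of strength 2 and index k, with rows I, columns T and symbols L. *)
Definition is_net := forall (i j : I) a b,
  i != j -> #|[set u | (f i u == a) && (f j u == b)]| = k.

Hypothesis fP : is_net.

Lemma card_net_block (i j : I) a : i != j -> #|[set u | f i u == a]| = (#|L| * k)%N.
Proof.
move=> ij; rewrite cardsE -sum1_card (partition_big (f j) predT) //=.
rewrite (eq_bigr (fun=> k)) ?sum_nat_const // => b _.
by rewrite -(fP a b ij) cardsE -sum1_card; apply: eq_bigl.
Qed.

Lemma card_net (i j : I) : i != j -> #|T| = (#|L| * (#|L| * k))%N.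
Proof.
move=> ij; rewrite -sum1_card (partition_big (f i) predT) //=.
rewrite (eq_bigr (fun=> #|L| * k)%N) ?sum_nat_const // => b _.
by rewrite -(card_net_block b ij) cardsE -sum1_card; apply: eq_bigl.
Qed.

Section Agree.
Variable R : comPzRingType.
Hypothesis I_gt1 : (1 < #|I|)%N.

(** Valued in R since the count is used over [algC] for spectra and over [int] for moments. *)
Definition agree u v : R := \sum_i (f i u == f i v)%:R.

Lemma agree_sym u v : agree u v = agree v u.
Proof. by apply: eq_bigr => i _; rewrite eq_sym. Qed.

Lemma agree_refl u : agree u u = #|I|%:R.
Proof. by rewrite /agree; under eq_bigr do rewrite eqxx; rewrite sumr_const. Qed.

Lemma other_index (i : I) : exists j, i != j.
Proof.
by have [x [y [_ _ xy]]] := card_gt1P I_gt1;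
  have [->|ix] := eqVneq i x; [exists y | exists x].
Qed.

Lemma sum_block i a : \sum_w (f i w == a)%:R = (#|L| * k)%:R :> R.
Proof.
have [j ij] := other_index i.
rewrite -(card_net_block a ij) -sum1_card natr_sum [RHS]big_mkcond /=.
by apply: eq_bigr => w _; rewrite inE; case: (_ == a).
Qed.

Lemma sum_block2 (i j : I) a b : i != j ->
  \sum_w (f i w == a)%:R * (f j w == b)%:R = k%:R :> R.
Proof.
move=> ij; rewrite -(fP a b ij) -sum1_card natr_sum [RHS]big_mkcond /=.
by apply: eq_bigr => w _; rewrite inE -natrM mulnb; case: (_ && _).
Qed.

(** Class i contributes its whole block or nothing; each other class contributes k, the size of the
    intersection of two blocks from different classes. *)
Lemma sum_block_agree i u v :
  \sum_w (f i u == f i w)%:R * agree w v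
  = (#|L| * k)%:R * (f i u == f i v)%:R + (#|I|.-1 * k)%:R :> R.
Proof.
under eq_bigr do rewrite mulr_sumr.
rewrite exchange_big /= (bigD1 i) //=; congr (_ + _).
  rewrite -(sum_block i (f i u)) mulr_suml; apply: eq_bigr => w _.
  rewrite [f i w == f i u]eq_sym; case: eqP => [->|]; by rewrite ?mul0r.
rewrite (eq_bigr (fun=> k%:R)) => [|j ji].
  by rewrite sumr_const cardC1 -mulrnA mulnC.
rewrite -(@sum_block2 i j (f i u) (f j v)) 1?eq_sym //.
by apply: eq_bigr => w _; rewrite [f i u == _]eq_sym.
Qed.

Lemma sum_agree u : \sum_w agree u w = (#|I| * (#|L| * k))%:R :> R.
Proof.
rewrite exchange_big /= (eq_bigr (fun=> (#|L| * k)%:R)) => [|i _].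
  by rewrite sumr_const -mulrnA mulnC.
by rewrite -(sum_block i (f i u)); apply: eq_bigr => w _; rewrite eq_sym.
Qed.

Lemma sum_agreeM u v :
  \sum_w agree u w * agree w v
  = (#|L| * k)%:R * agree u v + (#|I| * (#|I|.-1 * k))%:R :> R.
Proof.
under eq_bigr do rewrite mulr_suml.
rewrite exchange_big /=; under eq_bigr do rewrite sum_block_agree.
by rewrite big_split /= -mulr_sumr sumr_const -[in LHS]mulrnA [(#|I| * _)%N]mulnC.
Qed.

End Agree.

End Net.

Lemma sum_at_most_one (R : pzSemiRingType) (I : finType) (b : pred I) :
  (forall i j, b i -> b j -> i = j) -> \sum_i (b i)%:R = [exists i, b i]%:R :> R.
Proof.
move=> b1; case: existsP => [[i bi]|nb].
  rewrite (bigD1 i) //= bi big1 ?addr0 // => j ji.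
  by case bj: (b j) => //; rewrite (b1 _ _ bj bi) eqxx in ji.
by rewrite big1 // => i _; case bi: (b i) => //; case: nb; exists i.
Qed.

(** * Graphs with A + I = P - D: multiplicities, common neighbours, degree *)

Section TwoBlockGraph.
Variables (G : sgraph) (q n : nat) (L : finType) (f : 'I_q.+1 -> G -> L).
Variable D : G -> G -> algC.
Let P := agree f algC.

(** The common interface of both graphs, written as sums over vertices. The multiplicities derived
    from it involve only q and n, which yields cospectrality. *)
Record two_block : Prop := TwoBlock {
  tb_card : #|L| = (q * n)%N;
  tb_net : is_net f q;
  tb_sym : forall u v, D u v = D v u;
  tb_blockD : forall p u v,
    \sum_w (f p u == f p w)%:R * D w v = q%:R ^+ 2 * (f p u == f p v)%:R;
  tb_DD : forall u v, \sum_w D u w * D w v = q%:R ^+ 2 * D u v;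
  tb_D1 : forall u, \sum_w D u w = q%:R ^+ 2;
  tb_diag : forall u, D u u = q%:R;
  tb_adj : forall u v, (adj u v)%:R + (u == v)%:R = P u v - D u v
}.

Hypotheses (q_gt0 : (0 < q)%N) (GP : two_block).

Let I_gt1 : (1 < #|'I_q.+1|)%N. Proof. by rewrite card_ord ltnS. Qed.

Lemma two_block_PP u v : \sum_w P u w * P w v
  = q%:R ^+ 2 * n%:R * P u v + q%:R ^+ 2 * q.+1%:R.
Proof.
rewrite (sum_agreeM (tb_net GP)) // (tb_card GP) card_ord /=.
by rewrite !natrM -/P; ring.
Qed.

Lemma two_block_PD u v : \sum_w P u w * D w v = q%:R ^+ 2 * P u v.
Proof.
under eq_bigr do rewrite mulr_suml.
by rewrite exchange_big /= mulr_sumr; apply: eq_bigr => p _; rewrite (tb_blockD GP).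
Qed.

Lemma two_block_P1 u : \sum_w P u w = q.+1%:R * (q%:R ^+ 2 * n%:R).
Proof.
rewrite (sum_agree (tb_net GP)) // card_ord (tb_card GP) !natrM; ring.
Qed.

Lemma two_block_adjE u v : (adj u v)%:R = P u v - D u v - (u == v)%:R.
Proof. by rewrite -(tb_adj GP) addrK. Qed.

Lemma two_block_eigenvalue_mult a : (0 < n)%N ->
  (eigenvalue_mult G a)%:R =
  1 *+ (q%:R ^+ 3 * n%:R + q%:R ^+ 2 * n%:R - q%:R ^+ 2 - 1 == a)
  + (q.+1%:R * q%:R * n%:R - q%:R - 1) *+ (q%:R ^+ 2 * n%:R - q%:R ^+ 2 - 1 == a)
  + (q%:R ^+ 2 * n%:R ^+ 2 - q.+1%:R * q%:R * n%:R + q%:R) *+ (- q%:R ^+ 2 - 1 == a)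
  + (q%:R ^+ 3 * n%:R ^+ 2 - q%:R ^+ 2 * n%:R ^+ 2) *+ (- 1 == a) :> algC.
Proof.
move=> n_gt0; rewrite /eigenvalue_mult.
have onesE : const_mx 1 = fun_mx (fun _ _ : G => 1 : algC).
  by apply/matrixP => i j; rewrite !mxE.
have cardG : #|G| = (q ^ 3 * n ^ 2)%N.
  have [j ij] := other_index I_gt1 ord0.
  rewrite (card_net (tb_net GP) ij) (tb_card GP); ring.
have -> : adjmx G = fun_mx P - fun_mx D - 1%:M.
  apply/matrixP => i j; rewrite !mxE two_block_adjE.
  by rewrite (inj_eq enum_val_inj).
apply: rank_eigenspace_two_block => //; rewrite ?onesE.
- by apply/matrixP => i j; rewrite !mxE; exact: agree_sym.
- by apply/matrixP => i j; rewrite !mxE; exact: tb_sym.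
- by rewrite fun_mxM; apply/matrixP => i j; rewrite !mxE two_block_PP mulr1.
- by rewrite fun_mxM; apply/matrixP => i j; rewrite !mxE two_block_PD.
- by rewrite fun_mxM; apply/matrixP => i j; rewrite !mxE (tb_DD GP).
- rewrite fun_mxM; apply/matrixP => i j; rewrite !mxE.
  by under eq_bigr do rewrite mulr1; rewrite two_block_P1 mulr1.
- rewrite fun_mxM; apply/matrixP => i j; rewrite !mxE.
  by under eq_bigr do rewrite mulr1; rewrite (tb_D1 GP) mulr1.
- rewrite mxtrace_fun_mx; under eq_bigr do rewrite /P agree_refl card_ord.
  by rewrite sumr_const -mulrnA.
- rewrite mxtrace_fun_mx; under eq_bigr do rewrite (tb_diag GP).
  by rewrite sumr_const -mulrnA.
Qed.

Lemma two_block_common_nbrs u v : u != v ->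
  (common_nbrs u v)%:R = q%:R ^+ 2 * q.+1%:R + q%:R ^+ 2 * (n%:R - 1) * D u v
    + (q%:R ^+ 2 * (n%:R - 2) - 2) * (adj u v)%:R :> algC.
Proof.
move=> uv; have -> : (common_nbrs u v)%:R = \sum_w (adj u w)%:R * (adj w v)%:R :> algC.
  rewrite /common_nbrs -sum1_card natr_sum big_mkcond /=.
  by apply: eq_bigr => w _; rewrite inE (adj_sym w v) -natrM mulnb; case: (_ && _).
have DPE : \sum_w D u w * P w v = q%:R ^+ 2 * P u v.
  rewrite [P u v]agree_sym -two_block_PD.
  by apply: eq_bigr => w _; rewrite mulrC [P w v]agree_sym (tb_sym GP).
have idl (h : G -> G -> algC) : \sum_w (u == w)%:R * h w v = h u v.
  rewrite (bigD1 u) //= eqxx mul1r big1 ?addr0 // => w wu.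
  by rewrite eq_sym (negbTE wu) mul0r.
have idr (h : G -> G -> algC) : \sum_w h u w * (w == v)%:R = h u v.
  rewrite (bigD1 v) //= eqxx mulr1 big1 ?addr0 // => w wv.
  by rewrite (negbTE wv) mulr0.
(* The nine terms of the (u, v) entry of (P - D - I)^2. *)
transitivity (\sum_w P u w * P w v - \sum_w P u w * D w v - \sum_w P u w * (w == v)%:R
  - \sum_w D u w * P w v + \sum_w D u w * D w v + \sum_w D u w * (w == v)%:R
  - \sum_w (u == w)%:R * P w v + \sum_w (u == w)%:R * D w v
  + \sum_w (u == w)%:R * (w == v)%:R).
  rewrite -3!sumrB -2!big_split -sumrB -2!big_split /=.
  by apply: eq_bigr => w _; rewrite !two_block_adjE; ring.
rewrite two_block_PP two_block_PD DPE (tb_DD GP) !idr !idl two_block_adjE.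
by rewrite (idl (fun x y => (x == y)%:R)) (negbTE uv) /=; ring.
Qed.

Lemma two_block_regular : regular G.
Proof.
have deg x : #|[set y : G | adj x y]|%:R = q.+1%:R * (q%:R ^+ 2 * n%:R) - q%:R ^+ 2 - 1 :> algC.
  rewrite -sum1_card natr_sum big_mkcond /=.
  under eq_bigr => y _.
    rewrite (_ : (if _ then _ else _) = P x y - D x y - (x == y)%:R); last first.
      by rewrite -two_block_adjE ?inE; case: adj.
    over.
  rewrite !sumrB two_block_P1 (tb_D1 GP) (bigD1 x) //= eqxx big1 ?addr0 // => y yx.
  by rewrite eq_sym (negbTE yx).
have [x|G0] := pickP (@predT G).
  exists #|[set y : G | adj x y]| => y; apply/eqP.
  by rewrite -(eqr_nat algC) !deg.
by exists 0%N => x; have := G0 x.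
Qed.

End TwoBlockGraph.

Lemma two_block_cospectral (G H : sgraph) (q n : nat) (L M : finType)
    (f : 'I_q.+1 -> G -> L) (g : 'I_q.+1 -> H -> M) D E :
  (0 < q)%N -> (0 < n)%N -> two_block n f D -> two_block n g E -> cospectral G H.
Proof.
move=> q0 n0 GP HP a; apply/eqP; rewrite -(eqr_nat algC).
by rewrite (two_block_eigenvalue_mult q0 GP) ?(two_block_eigenvalue_mult q0 HP).
Qed.

Lemma card_fiber_inj (T U : finType) (g : T -> U) y :
  injective g -> #|T| = #|U| -> #|[set x | g x == y]| = 1%N.
Proof.
move=> g_inj TU; have [h gK hK] := inj_card_bij g_inj (eq_leq (esym TU)).
rewrite -(cards1 (h y)); apply: eq_card => x; rewrite !inE.
by apply/eqP/eqP => [<-|->].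
Qed.

(** * The clique extension of a Latin square graph *)

Section LatinSquareTwoBlock.
Variables (q n : nat) (C : 'M['I_(q * n)]_(q.+1, (q * n) ^ 2)).
Hypothesis CP : is_OA C.

Definition ls_label (p : 'I_q.+1) (u : clique_ext q (LS C)) := C p u.1.
Definition ls_twist (u v : clique_ext q (LS C)) : algC := q%:R * (u.1 == v.1)%:R.

(** Two labels determine one array column, hence the q vertices of its clique. *)
Lemma ls_label_net : is_net ls_label q.
Proof.
move=> p p' a b pp'.
transitivity #|setX [set c | (C p c, C p' c) == (a, b)] [set: 'I_q]|.
  by apply: eq_card => u; rewrite !inE andbT xpair_eqE.
rewrite cardsX cardsT card_ord (card_fiber_inj _ (CP pp')) ?mul1n //.
by rewrite card_prod !card_ord mulnn.
Qed.

Lemma sum_ls_twist (h : clique_ext q (LS C) -> algC) v :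
  (forall u w, u.1 = w.1 -> h u = h w) ->
  \sum_w h w * ls_twist w v = q%:R ^+ 2 * h v.
Proof.
move=> hE; transitivity (\sum_(k < q) \sum_(i < (q * n) ^ 2) h (i, k) * ls_twist (i, k) v).
  by rewrite exchange_big pair_bigA; apply: eq_bigr => -[].
rewrite (eq_bigr (fun=> q%:R * h v)) => [|k _].
  by rewrite sumr_const card_ord -[LHS]mulr_natl mulrA -expr2.
rewrite (bigD1 v.1) //= big1 ?addr0 => [|i iv]; rewrite /ls_twist /=.
  by rewrite eqxx mulr1 mulrC (hE _ v).
by rewrite (negbTE iv) !mulr0.
Qed.

Lemma ls_two_block : two_block n ls_label ls_twist.
Proof.
have twist_sym u v : ls_twist u v = ls_twist v u by rewrite /ls_twist eq_sym.
split => [||//|p u v|u v|u|u|u v].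
- by rewrite card_ord.
- exact: ls_label_net.
- apply: (sum_ls_twist (h := fun w => (ls_label p u == ls_label p w)%:R)) => w w' ww'.
  by rewrite /ls_label ww'.
- by apply: (sum_ls_twist (h := ls_twist u)) => w w' ww'; rewrite /ls_twist ww'.
- under eq_bigr do rewrite twist_sym -[ls_twist _ _]mul1r.
  by rewrite (sum_ls_twist (h := fun=> 1)) ?mulr1.
- by rewrite /ls_twist eqxx mulr1.
- rewrite /agree /ls_twist /= /clique_ext_adj /LS_adj /=.
  have [uv|uv] /= := eqVneq u.1 v.1.
    (* Inside a clique all q + 1 labels agree and the twist is q, which leaves 1. *)
    rewrite andbT (eq_bigr (fun=> 1)) => [|p _]; last by rewrite /ls_label uv eqxx.
    rewrite sumr_const card_ord mulr1 [q.+1%:R]mulrS addrK.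
    by case: eqP => _; rewrite ?addr0 ?add0r.
  have uv' : u != v by apply: contraNneq uv => ->.
  (* Distinct columns agree in at most one row, so here P itself is the indicator of adjacency. *)
  rewrite uv' (negbTE uv') mulr0 subr0 addr0 /LS_adj uv /= sum_at_most_one // => p p'.
  move=> /eqP e /eqP e'; apply: contraNeq uv => /CP/(_ u.1 v.1) uvE.
  by apply/eqP/uvE; rewrite [C p _]e [C p' _]e'.
Qed.

End LatinSquareTwoBlock.

(** * Parallel classes of planes as a net on the affine space *)

Section ParallelClassFamily.
Variables (F : finFieldType) (q : nat) (S : 'I_q.+1 -> 'I_q -> {set 'rV[F]_3}).
Hypotheses (hF : #|F| = q) (SP : is_TLS_classes S).

Let q_gt1 : (1 < q)%N. Proof. by rewrite -hF finNzRing_gt1. Qed.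

(** The q^2 intersections of a plane of class p with a plane of another class are pairwise disjoint
    and have q points each, so they fill all q^3 points. *)
Lemma TLS_classes_cover p x : exists l, x \in S p l.
Proof.
have [Spar S2 _] := SP.
have [p' pp'] : exists p', p != p'.
  by apply: other_index; rewrite card_ord ltnS (ltnW q_gt1).
have uniq_mem r y : (\sum_l (y \in S r l) <= 1)%N.
  have [_ Sdisj'] := Spar r.
  have [l yl|y0] := pickP (fun l => y \in S r l); last first.
    by rewrite big1 // => l _; rewrite y0.
  rewrite (bigD1 l) //= yl big1 // => l' l'l.
  by rewrite (disjointFr (Sdisj' l l' _) yl) // eq_sym.
pose A := [set y | [exists l, y \in S p l]].
suff: A = setT by move/setP/(_ x); rewrite !inE => /existsP.
apply/eqP; rewrite eqEcard subsetT cardsT card_mx hF /=.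
have -> : (q ^ (1 * 3) = \sum_y (\sum_l (y \in S p l)) * (\sum_l (y \in S p' l)))%N.
  under eq_bigr => y _ do (rewrite big_distrl /=; under eq_bigr do rewrite big_distrr /=).
  rewrite exchange_big /=; under eq_bigr do rewrite exchange_big /=.
  rewrite (eq_bigr (fun=> \sum_(l' < q) q)%N) => [|l _].
    by rewrite !sum_nat_const card_ord; ring.
  apply: eq_bigr => l' _.
  transitivity #|S p l :&: S p' l'|; last exact: S2.
  rewrite -sum1_card [RHS]big_mkcond /=.
  by apply: eq_bigr => y _; rewrite inE mulnb; case: (_ && _).
rewrite -sum1_card [leqRHS]big_mkcond /=; apply: leq_sum => y _; rewrite inE.
case: existsP => [_|y0]; first exact: leq_mul (uniq_mem _ _) (uniq_mem _ _).
by rewrite big1 // => l _; case yl: (y \in _) => //; case: y0; exists l.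
Qed.

Lemma TLS_classes_fun : exists c : 'I_q.+1 -> 'rV[F]_3 -> 'I_q,
  forall p l x, (x \in S p l) = (c p x == l).
Proof.
exists (fun p x => xchoose (TLS_classes_cover p x)) => p l x.
have xc := xchooseP (TLS_classes_cover p x).
apply/idP/eqP => [xl|<- //]; apply/eqP/contraT => cl.
have [/(_ p)[_ Sdisj] _ _] := SP.
by rewrite (disjointFr (Sdisj _ _ cl) xc) in xl.
Qed.

Variable c : 'I_q.+1 -> 'rV[F]_3 -> 'I_q.
Hypothesis cP : forall p l x, (x \in S p l) = (c p x == l).

Lemma TLS_class_net : is_net c q.
Proof.
move=> p p' l l' pp'; have [_ S2 _] := SP.
rewrite -[RHS](S2 p p' l l' pp'); apply: eq_card => x.
by rewrite !inE !cP.
Qed.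

Lemma TLS_class_inj x y : x != y -> (#|[set p | c p x == c p y]| <= 2)%N.
Proof.
move=> xy; have key (h i j : 'I_q.+1) : (h < i)%N -> (i < j)%N ->
    c h x = c h y -> c i x = c i y -> c j x = c j y -> False.
  move=> hi ij hE iE jE; have [_ _ /(_ h i j (c h x) (c i x) (c j x) hi ij)] := SP.
  move/eqP/cards1P => [z zE]; case/eqP: xy.
  have: x \in [set z] by rewrite -zE !inE !cP !eqxx.
  have: y \in [set z] by rewrite -zE !inE !cP hE iE jE !eqxx.
  by rewrite !inE => /eqP-> /eqP->.
rewrite leqNgt; apply/card_gt2P => -[h [i [j [[]]]]]; rewrite !inE.
move=> /eqP hE /eqP iE /eqP jE [hi ij jh].
move: hi ij jh; rewrite -!val_eqE /=.
(* Condition (2) is stated for increasing indices: six of the eight sign patterns are orderings of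
   h, i, j and two are impossible cycles. *)
case: ltngtP => // ltA _; case: ltngtP => // ltB _; case: ltngtP => // ltC _;
  by [apply: (key h i j) | apply: (key h j i) | apply: (key i h j)
     | apply: (key i j h) | apply: (key j h i) | apply: (key j i h)
     | have := ltn_trans ltA (ltn_trans ltB ltC); rewrite ltnn
     | have := ltn_trans (ltn_trans ltC ltB) ltA; rewrite ltnn].
Qed.

Lemma agree_card (R : comPzRingType) x y : agree c R x y = #|[set p | c p x == c p y]|%:R.
Proof.
rewrite /agree -sum1_card natr_sum [RHS]big_mkcond /=.
by apply: eq_bigr => p _; rewrite inE; case: (_ == _).
Qed.

(** The left-hand side of the hypothesis is the sum of a m^2 + b m + d over all y other than x,
    computed from the moments of m minus the term m = q + 1 at y = x; a nonzero sum has a nonzero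
    term. *)
Lemma TLS_class_moment (x : 'rV[F]_3) (a b d : int) :
  a * (q%:Z ^+ 2 * q.+1%:Z * 2 - q.+1%:Z ^+ 2) + b * (q.+1%:Z * (q%:Z ^+ 2 - 1))
    + d * (q%:Z ^+ 3 - 1) != 0 ->
  exists2 y, x != y &
    let m := (#|[set p | c p x == c p y]|)%:Z in a * m ^+ 2 + b * m + d != 0.
Proof.
have I_gt1 : (1 < #|'I_q.+1|)%N by rewrite card_ord ltnS (ltnW q_gt1).
move=> sum_neq0; pose g y := let m := (#|[set p | c p x == c p y]|)%:Z in a * m ^+ 2 + b * m + d.
suff /existsP[y /andP[xy gy]] : [exists y, (x != y) && (g y != 0)] by exists y.
apply: contraNT sum_neq0; rewrite negb_exists => /forallP m0.
pose m y := agree c int x y.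
have mxx : m x = q.+1%:Z by rewrite /m agree_refl card_ord natz.
have sum1 : \sum_y m y = q.+1%:Z * q%:Z ^+ 2.
  by rewrite (sum_agree TLS_class_net) // !card_ord natz; lia.
have sum2 : \sum_y m y ^+ 2 = q%:Z ^+ 2 * q.+1%:Z * 2.
  transitivity (\sum_y agree c int x y * agree c int y x).
    by apply: eq_bigr => y _; rewrite expr2 [agree _ _ y x]agree_sym.
  rewrite (sum_agreeM TLS_class_net) // agree_refl !card_ord /= !natz; lia.
have : \sum_(y | y != x) (a * m y ^+ 2 + b * m y + d) = 0.
  rewrite big1 // => y yx; have := m0 y.
  by rewrite eq_sym yx /= negbK /g /= -[_%:Z]natz -agree_card => /eqP.
move=> <-.
have : \sum_y (a * m y ^+ 2 + b * m y + d)
   = a * (q%:Z ^+ 2 * q.+1%:Z * 2) + b * (q.+1%:Z * q%:Z ^+ 2) + d * q%:Z ^+ 3.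
  rewrite !big_split /= -!mulr_sumr sum1 sum2 sumr_const card_mx hF -[d *+ _]mulr_natr.
  by rewrite natz; lia.
rewrite (bigD1 x) //= mxx => /(canRL (addKr _)) ->.
by apply/eqP; ring.
Qed.

Lemma TLS_class_meet t x : (t <= 2)%N ->
  exists2 y, x != y & #|[set p | c p x == c p y]| = t.
Proof.
have qE : q.+1%:Z = q%:Z + 1 by lia.
have [q0 q1 q2] : [/\ q%:Z != 0, q%:Z - 1 != 0 & q%:Z + 1 != 0] by split; have := q_gt1; lia.
move=> t2.
have [a [b [d [sum_neq0 root]]]] : exists a b d : int,
    a * (q%:Z ^+ 2 * q.+1%:Z * 2 - q.+1%:Z ^+ 2) + b * (q.+1%:Z * (q%:Z ^+ 2 - 1))
      + d * (q%:Z ^+ 3 - 1) != 0 /\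
    forall m : nat, (m <= 2)%N -> a * m%:Z ^+ 2 + b * m%:Z + d != 0 -> m = t.
  (* The quadratics are (m - 1)(m - 2), m (m - 2) and m (m - 1): each vanishes at the two values
     among 0, 1, 2 other than t. *)
  case: t t2 => [|[|[|//]]] _.
  - exists 1, (-3), 2; split; last by case=> [|[|[|]]].
    by rewrite qE (_ : _ + _ = q%:Z * (q%:Z - 1) ^+ 2) ?mulf_neq0 ?expf_neq0 //; ring.
  - exists 1, (-2), 0; split; last by case=> [|[|[|]]].
    by rewrite qE (_ : _ + _ = - (q%:Z + 1) * (q%:Z - 1)) ?mulf_neq0 ?oppr_eq0 //; ring.
  - exists 1, (-1), 0; split; last by case=> [|[|[|]]].
    by rewrite qE (_ : _ + _ = (q%:Z + 1) * q%:Z * (q%:Z - 1)) ?mulf_neq0 //; ring.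
have [y xy /root mt] := TLS_class_moment x sum_neq0.
by exists y; last exact/mt/TLS_class_inj.
Qed.

End ParallelClassFamily.

(** * Twisted Latin square graphs *)

Section TwistedLatinSquareTwoBlock.
Variables (F : finFieldType) (q n : nat).
Variables (O : 'I_q.+1 -> 'M['I_n]_(q, n ^ 2)) (S : 'I_q.+1 -> 'I_q -> {set 'rV[F]_3}).
Hypotheses (hF : #|F| = q) (OP : is_GOA O) (SP : is_TLS_classes S).
Variable c : 'I_q.+1 -> 'rV[F]_3 -> 'I_q.
Hypothesis cP : forall p l x, (x \in S p l) = (c p x == l).

Let q_gt1 : (1 < q)%N. Proof. by rewrite -hF finNzRing_gt1. Qed.
Let I_gt1 : (1 < #|'I_q.+1|)%N. Proof. by rewrite card_ord ltnS (ltnW q_gt1). Qed.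
Let cN : is_net c q := TLS_class_net SP cP.

(** The plane of class p through the point selects the row of group p to be read; keeping its index
    separates the symbols of different rows and gives q n labels. *)
Definition tls_label (p : 'I_q.+1) (u : TLS O S) : 'I_q * 'I_n :=
  (c p u.1, O p (c p u.1) u.2).
Definition class_twist x y : algC := agree c algC x y - 1.
Definition tls_twist (u v : TLS O S) : algC := (u.2 == v.2)%:R * class_twist u.1 v.1.

(** Two labels fix two planes, which meet in q points, and entries in two rows of different groups,
    which fix the column. *)
Lemma tls_label_net : is_net tls_label q.
Proof.
move=> p p' [l a] [l' a'] pp'.
transitivity #|setX [set x | (c p x == l) && (c p' x == l')]
                    [set i | (O p l i, O p' l' i) == (a, a')]|.
  apply: eq_card => u; rewrite !inE !xpair_eqE andbACA.
  by case: eqP => [<-|]; case: eqP => [<-|].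
rewrite cardsX (cN _ _ pp') (card_fiber_inj _ (@OP p p' l l' pp')) ?muln1 //.
by rewrite card_prod !card_ord mulnn.
Qed.

(** The contribution q * q of the q other classes cancels against the plane size q^2; the - 1 in
    [class_twist] is there for this. *)
Lemma sum_class_twist p x y :
  \sum_z (c p x == c p z)%:R * class_twist z y = q%:R ^+ 2 * (c p x == c p y)%:R.
Proof.
under eq_bigr do rewrite mulrBr mulr1.
rewrite sumrB (sum_block_agree cN) // !card_ord /=.
under [X in _ - X]eq_bigr do rewrite eq_sym.
by rewrite (sum_block cN) // card_ord addrK natrM.
Qed.

Lemma sum_class_twist1 y : \sum_z class_twist z y = q%:R ^+ 2.
Proof.
rewrite sumrB; under eq_bigr do rewrite agree_sym.
rewrite (sum_agree cN) // !card_ord sumr_const card_mx hF !natrM -natrX [q.+1%:R]mulrS.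
by rewrite expnS expnSr; ring.
Qed.

Lemma sum_class_twistM x y :
  \sum_z class_twist x z * class_twist z y = q%:R ^+ 2 * class_twist x y.
Proof.
under eq_bigr do rewrite mulrBl mul1r mulr_suml.
rewrite sumrB exchange_big /= sum_class_twist1.
under eq_bigr do rewrite sum_class_twist.
by rewrite -mulr_sumr mulrBr mulr1.
Qed.

Lemma sum_tls_twist (h : TLS O S -> algC) v :
  \sum_w h w * tls_twist w v = \sum_z h (z, v.2) * class_twist z v.1.
Proof.
transitivity (\sum_z \sum_(k < n ^ 2) h (z, k) * tls_twist (z, k) v).
  by rewrite pair_bigA; apply: eq_bigr => -[].
apply: eq_bigr => z _; rewrite (bigD1 v.2) //= big1 ?addr0 => [|k kv]; rewrite /tls_twist /=.
  by rewrite eqxx mul1r.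
by rewrite (negbTE kv) mul0r mulr0.
Qed.

Lemma tls_twist_sym u v : tls_twist u v = tls_twist v u.
Proof. by rewrite /tls_twist /class_twist agree_sym eq_sym. Qed.

Lemma tls_adjE (u v : TLS O S) : u.2 != v.2 ->
  adj u v = [exists p, tls_label p u == tls_label p v].
Proof.
move=> uv; have uv' : u != v by apply: contraNneq uv => ->.
rewrite /= /TLS_adj uv' (negbTE uv) /=; apply: eq_existsb => p.
apply/existsP/eqP => [[l]|[e1 e2]].
  by rewrite !cP => /and3P[/eqP e1 /eqP e2 /eqP e3]; rewrite /tls_label e1 e2 e3.
by exists (c p u.1); rewrite !cP e2 e1 !eqxx.
Qed.

Lemma tls_two_block : two_block n tls_label tls_twist.
Proof.
split => [||||u v|u|u|u v].
- by rewrite card_prod !card_ord.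
- exact: tls_label_net.
- exact: tls_twist_sym.
- move=> p u v; rewrite (sum_tls_twist (fun w => (tls_label p u == tls_label p w)%:R)).
  transitivity ((O p (c p u.1) u.2 == O p (c p u.1) v.2)%:R *
                \sum_z (c p u.1 == c p z)%:R * class_twist z v.1).
    rewrite mulr_sumr; apply: eq_bigr => z _; rewrite xpair_eqE /=.
    by case: eqP => [<-|]; rewrite /= ?mul1r // !mul0r mulr0.
  rewrite sum_class_twist xpair_eqE /=; case: (c p u.1 =P c p v.1) => [<-|_].
    by rewrite mulr1 mulrC.
  by rewrite !mulr0.
- rewrite (sum_tls_twist (tls_twist u)) /tls_twist /=.
  under eq_bigr do rewrite -mulrA.
  by rewrite -mulr_sumr sum_class_twistM mulrCA.
- under eq_bigr do rewrite tls_twist_sym -[tls_twist _ _]mul1r.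
  rewrite (sum_tls_twist (fun=> 1)); under eq_bigr do rewrite mul1r.
  exact: sum_class_twist1.
- by rewrite /tls_twist /class_twist eqxx agree_refl card_ord mul1r [q.+1%:R]mulrS addrAC subrr add0r.
- have [uv|uv] := eqVneq u.2 v.2.
    rewrite /tls_twist uv eqxx mul1r /class_twist /= /TLS_adj uv eqxx /= andbT.
    (* Within a column, labels agree exactly when planes do, so P - D = K - (K - 1) = 1. *)
    have -> : agree tls_label algC u v = agree c algC u.1 v.1.
      apply: eq_bigr => p _; rewrite xpair_eqE uv.
      by case: eqP => [->|//]; rewrite eqxx.
    rewrite subKr.
    by case: eqP => _; rewrite ?addr0 ?add0r.
  have uv' : u != v by apply: contraNneq uv => ->.
  rewrite tls_adjE // /tls_twist (negbTE uv) mul0r subr0 (negbTE uv') addr0 /agree.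
  (* Two distinct columns cannot agree on rows of two different groups. *)
  rewrite sum_at_most_one // => p p'.
  move=> /eqP[e1 e2] /eqP[e1' e2']; apply: contraNeq uv => pp'.
  by apply/eqP/(@OP p p' (c p u.1) (c p' u.1) pp'); rewrite e2 e2' e1 e1'.
Qed.

(** Non-adjacent vertices lie in different columns, where the twist is 0. *)
Lemma TLS_co_edge_regular : exists mu, co_edge_regular (TLS O S) mu.
Proof.
have q_gt0 := ltnW q_gt1.
exists (q ^ 2 * q.+1)%N; split; first exact: two_block_regular tls_two_block.
move=> u v uv auv; apply/eqP; rewrite -(eqr_nat algC).
rewrite (two_block_common_nbrs q_gt0 tls_two_block uv) (negbTE auv) mulr0 addr0.
rewrite /tls_twist; case: (u.2 =P v.2) => [uv2|_]; last by rewrite mul0r mulr0 addr0 natrM natrX.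
by move: auv; rewrite /= /TLS_adj uv uv2 eqxx.
Qed.

Lemma TLS_cospectral (C : 'M['I_(q * n)]_(q.+1, (q * n) ^ 2)) : (0 < n)%N ->
  is_OA C -> cospectral (TLS O S) (clique_ext q (LS C)).
Proof.
move=> n_gt0 CP.
exact: two_block_cospectral (ltnW q_gt1) n_gt0 tls_two_block (ls_two_block CP).
Qed.

Lemma TLS_common_nbrs_adj (u v : TLS O S) : adj u v ->
  (common_nbrs u v)%:R =
  q%:R ^+ 2 * q.+1%:R + (q%:R ^+ 2 * (n%:R - 2) - 2)
  + q%:R ^+ 2 * (n%:R - 1) * tls_twist u v :> algC.
Proof.
move=> auv; have uv : u != v by apply: contraTneq auv => ->; rewrite adj_irr.
by rewrite (two_block_common_nbrs (ltnW q_gt1) tls_two_block uv) auv mulr1 addrAC.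
Qed.

(** On edges the number of common neighbours is affine in the twist with slope q^2 (n - 1), nonzero
    for n > 1, and the twist takes exactly the values -1, 0, 1. For n = 1 the graph is complete. *)
Lemma TLS_level : (1 < n)%N -> level (TLS O S) = 3%N.
Proof.
move=> n_gt1.
have i0 : 'I_(n ^ 2) by apply: (Ordinal (n := n ^ 2) (m := 0)); rewrite expn_gt0 (ltnW n_gt1).
have meet t : (t <= 2)%N -> exists2 e : TLS O S * TLS O S, adj e.1 e.2 & tls_twist e.1 e.2 = t%:R - 1.
  move=> /(TLS_class_meet hF SP cP 0)[y xy mt]; exists ((0, i0), (y, i0)).
    by rewrite /= /TLS_adj xpair_eqE negb_and xy eqxx.
  by rewrite /tls_twist eqxx mul1r /class_twist agree_card mt.
have twist_val (u v : TLS O S) : adj u v ->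
    exists2 t : nat, (t <= 2)%N & tls_twist u v = t%:R - 1.
  move=> auv; rewrite /tls_twist; case: (u.2 =P v.2) => [uv|_]; last first.
    (* Edges between columns have twist 0, the same as pairs in a column sharing one plane. *)
    by exists 1%N; rewrite ?mul0r ?subrr.
  have xy : u.1 != v.1.
    apply: contraTneq auv => uv1; rewrite [u]surjective_pairing [v]surjective_pairing.
    by rewrite uv uv1 adj_irr.
  exists #|[set p | c p u.1 == c p v.1]|; first exact: (TLS_class_inj SP cP xy).
  by rewrite mul1r /class_twist agree_card.
have twist_nbrs (e e' : TLS O S * TLS O S) : adj e.1 e.2 -> adj e'.1 e'.2 ->
    (common_nbrs e.1 e.2 == common_nbrs e'.1 e'.2) = (tls_twist e.1 e.2 == tls_twist e'.1 e'.2).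
  move=> ae ae'; rewrite -(eqr_nat algC) !TLS_common_nbrs_adj //.
  rewrite (inj_eq (addrI _)) (inj_eq (mulfI _)) // mulf_neq0 ?expf_neq0 //.
    by rewrite pnatr_eq0 -lt0n ltnW.
  by rewrite subr_eq0 pnatr_eq1 neq_ltn n_gt1 orbT.
have [e0 a0 t0] := meet 0%N isT; have [e1 a1 t1] := meet 1%N isT.
have [e2 a2 t2] := meet 2%N isT.
pose N (e : TLS O S * TLS O S) := common_nbrs e.1 e.2.
rewrite /level; set s := [seq _ | _ in _].
rewrite (perm_size (_ : perm_eq _ [:: N e0; N e1; N e2])) //.
apply: uniq_perm; first exact: undup_uniq.
  rewrite /= !inE !twist_nbrs // t0 t1 t2 !(inj_eq (addIr _)) !eqr_nat //.
move=> m; rewrite mem_undup !inE; apply/imageP/idP => [[e ae ->]|].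
  have [t t2' te] := twist_val _ _ ae.
  rewrite !twist_nbrs // te t0 t1 t2 !(inj_eq (addIr _)) !eqr_nat.
  by case: t t2' {te} => [|[|[|]]].
by case/or3P => /eqP->; [exists e0 | exists e1 | exists e2].
Qed.

End TwistedLatinSquareTwoBlock.

(** * Group-divisible orthogonal arrays for arbitrarily large n *)

Lemma natr_Fp_inj p a b : prime p -> (a < p)%N -> (b < p)%N ->
  a%:R = b%:R :> 'F_p -> a = b.
Proof.
by move=> pp ap bp /(congr1 val); rewrite /= !val_Fp_nat // !modn_small.
Qed.

(* The lines of the affine plane over a large prime field, in q + 1 of its
   parallel classes, every row being repeated q times. *)
Lemma GOA_exists q M : exists n, (M < n)%N /\
  exists O : 'I_q.+1 -> 'M['I_n]_(q, n ^ 2), is_GOA O.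
Proof.
(* Exceeding q keeps the slopes 0, ..., q distinct modulo p. *)
have [p pM pp] := prime_above (maxn M q); move: pM; rewrite gtn_max => /andP[Mp qp].
exists p; split => //.
have cFF : (p ^ 2)%N = #|{: 'F_p * 'F_p}| by rewrite card_prod card_Fp.
pose e (k : 'I_(p ^ 2)) : 'F_p * 'F_p := enum_val (cast_ord cFF k).
have e_inj : injective e by move=> k k' /enum_val_inj/cast_ord_inj.
pose d (x : 'F_p) : 'I_p := cast_ord (card_Fp pp) (enum_rank x).
have d_inj : injective d by move=> x x' /cast_ord_inj/enum_rank_inj.
exists (fun g => \matrix_(l, k) d (g%:R * (e k).1 + (e k).2)).
move=> g g' l l' gg' k k' /=; rewrite !mxE => H; apply: e_inj.
have E := d_inj _ _ (congr1 fst H); have E' := d_inj _ _ (congr1 snd H).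
have gg0 : g%:R - g'%:R != 0 :> 'F_p.
  rewrite subr_eq0; apply: contraNneq gg' => /natr_Fp_inj gE.
  by apply/eqP/val_inj/gE => //; exact: leq_trans (ltn_ord _) qp.
have x0 : (e k).1 = (e k').1.
  apply: (mulfI gg0).
  transitivity (g%:R * (e k).1 + (e k).2 - (g'%:R * (e k).1 + (e k).2)); first by ring.
  by rewrite /= E E'; ring.
move: E; rewrite x0 => /addrI y0.
by rewrite [e k]surjective_pairing x0 y0 -surjective_pairing.
Qed.

(** * Parallel classes from a dual conic *)

Section DualConic.
Variable F : finFieldType.

(* The q + 1 points of a conic in the dual of PG(2, q); None is the point at
   infinity. *)
Definition conic_form (o : option F) : 'cV[F]_3 :=
  if o is Some t then \col_i t ^+ i else delta_mx ord_max 0.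

Definition conic_val o (x : 'rV[F]_3) : F := (x *m conic_form o) 0 0.

Lemma conic_valB o x y : conic_val o (x - y) = conic_val o x - conic_val o y.
Proof. by rewrite /conic_val mulmxBl [LHS]mxE [X in _ + X]mxE. Qed.

Lemma conic_valZ o a x : conic_val o (a *: x) = a * conic_val o x.
Proof. by rewrite /conic_val -scalemxAl [LHS]mxE. Qed.

(** A vector is read as a polynomial of degree at most 2: finite conic points evaluate it, the point
    at infinity extracts its coefficient of degree 2. *)
Lemma conic_val_Some t x : conic_val (Some t) x = (rVpoly x).[t].
Proof.
rewrite (horner_coef_wide _ (size_poly _ _)) /conic_val mxE.
by apply: eq_bigr => i _; rewrite coef_rVpoly_ord mxE.
Qed.

Lemma conic_val_None x : conic_val None x = (rVpoly x)`_2.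
Proof.
rewrite -[2%N]/(val (ord_max : 'I_3)) coef_rVpoly_ord /conic_val mxE (bigD1 ord_max) //=.
rewrite big1 ?addr0 => [|i im]; first by rewrite mxE !eqxx mulr1.
by rewrite mxE (negbTE im) mulr0.
Qed.

(** Three points of a conic are independent: a nonzero polynomial of degree at most 2 has at most
    two roots, and at most one if its quadratic coefficient vanishes. *)
Lemma conic_val_eq0 (s : seq (option F)) x :
  uniq s -> size s = 3%N -> all (fun o => conic_val o x == 0) s -> x = 0.
Proof.
move=> s_uniq s3 sx; apply: (can_inj rVpolyK); rewrite linear0.
have [//|p0] := eqVneq (rVpoly x) 0.
have size3 : (size (rVpoly x) <= 3)%N := size_poly _ _.
have size2 : conic_val None x == 0 -> (size (rVpoly x) <= 2)%N.
  move/eqP; rewrite conic_val_None => x2; apply/leq_sizeP => -[|[|[|j]]] // _.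
  exact: (leq_sizeP _ _ size3).
have roots (rs : seq F) : uniq rs -> all (fun t => conic_val (Some t) x == 0) rs ->
    (size rs < size (rVpoly x))%N.
  move=> rs_uniq rs0; apply: max_poly_roots => //; apply: sub_all rs0 => t.
  by rewrite conic_val_Some.
have noroots2 t t' : t != t' -> conic_val (Some t) x == 0 -> conic_val (Some t') x == 0 ->
    conic_val None x == 0 -> False.
  move=> tt' t0 t0' /size2; rewrite leqNgt (roots [:: t; t']) //=; last by rewrite t0 t0'.
  by rewrite inE tt'.
case: s s_uniq s3 sx => [|o1 [|o2 [|o3 [|//]]]] //=.
rewrite !inE negb_or !andbT => /andP[/andP[o12 o13] o23] _ /and3P[h1 h2 h3].
case: o1 o2 o3 o12 o13 o23 h1 h2 h3 => [t1|] [t2|] [t3|] // o12 o13 o23 h1 h2 h3.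
- move: size3; rewrite leqNgt (roots [:: t1; t2; t3]) //=; last by rewrite h1 h2 h3.
  by rewrite !inE negb_or andbT (o12 : t1 != t2) (o13 : t1 != t3) (o23 : t2 != t3).
- by case: (noroots2 t1 t2).
- by case: (noroots2 t1 t3).
- by case: (noroots2 t2 t3).
Qed.

Lemma conic_plane o (a : F) : is_plane [set x | conic_val o x == a].
Proof.
pose f := linfun (mulmxr (conic_form o) : 'rV[F]_3 -> 'rV[F]_1).
have fE x : f x = (conic_val o x)%:M.
  by rewrite lfunE /= [LHS]mx11_scalar.
(* This vector serves twice: [a *: x1] is the base point of the plane, and its multiples show the
   form surjective, so the kernel has dimension 2. *)
have [x1 x1E] : exists x1, conic_val o x1 = 1.
  case: o {f fE} => [t|]; [exists (delta_mx 0 ord0) | exists (delta_mx 0 ord_max)].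
    by rewrite /conic_val -rowE !mxE expr0.
  by rewrite /conic_val -rowE !mxE !eqxx.
exists (a *: x1), (lker f); split.
  have := limg_ker_dim f fullv; rewrite capfv dimvf dim_matrix.
  suff -> : limg f = fullv by rewrite !dimvf !dim_matrix; exact: (@addIn 1 _ 2).
  apply/vspaceP => y; rewrite memvf; apply/memv_imgP; exists (y 0 0 *: x1).
    exact: memvf.
  rewrite fE conic_valZ x1E mulr1.
  exact: mx11_scalar.
apply/setP => x; rewrite !in_set memv_ker fE -subr_eq0.
have -> : conic_val o (x - a *: x1) = conic_val o x - a.
  by rewrite conic_valB conic_valZ x1E mulr1.
apply/eqP/eqP => [->|/matrixP/(_ 0 0)]; first exact: raddf0.
by rewrite !mxE eqxx mulr1n.
Qed.

(** Independence makes the triple of forms injective between two sets of equal size, hence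
    bijective. *)
Lemma card_conic_flag o1 o2 o3 (a b d : F) : uniq [:: o1; o2; o3] ->
  #|[set x | [&& conic_val o1 x == a, conic_val o2 x == b & conic_val o3 x == d]]| = 1%N.
Proof.
move=> o_uniq; pose g x := (conic_val o1 x, conic_val o2 x, conic_val o3 x).
transitivity #|[set x | g x == (a, b, d)]|; last apply: card_fiber_inj.
- by apply: eq_card => x; rewrite !inE !xpair_eqE andbA.
- move=> x y [e1 e2 e3]; apply/eqP; rewrite -subr_eq0; apply/eqP.
  by apply: (conic_val_eq0 o_uniq) => //=; rewrite !conic_valB e1 e2 e3 !subrr eqxx.
- by rewrite card_mx !card_prod; ring.
Qed.

End DualConic.

Lemma TLS_classes_exist (F : finFieldType) (q : nat) : #|F| = q ->
  exists S : 'I_q.+1 -> 'I_q -> {set 'rV[F]_3}, is_TLS_classes S.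
Proof.
move=> hF; have q_gt1 : (1 < q)%N by rewrite -hF finNzRing_gt1.
have cO : q.+1 = #|{: option F}| by rewrite card_option hF.
pose o (i : 'I_q.+1) : option F := enum_val (cast_ord cO i).
have o_inj : injective o by move=> i j /enum_val_inj/cast_ord_inj.
pose v (l : 'I_q) : F := enum_val (cast_ord (esym hF) l).
have v_inj : injective v by move=> i j /enum_val_inj/cast_ord_inj.
pose S i l := [set x | conic_val (o i) x == v l].
exists S; split.
- move=> i; split=> [l|l l' ll']; first exact: conic_plane.
  rewrite -setI_eq0; apply/eqP/setP => x; rewrite !inE.
  by apply: contraNF ll' => /andP[/eqP-> /eqP/v_inj->].
- move=> i j l l' ij.
  (* As q + 1 > 2, a third class exists; its q planes cut the intersection into single points. *)
  have [k] : exists k, k \in ~: [set i; j].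
    apply/set0Pn; rewrite -card_gt0 cardsCs setCK cards2 ij card_ord subn_gt0.
    by rewrite ltnS.
  rewrite !inE negb_or => /andP[ki kj].
  rewrite -sum1_card (partition_big (conic_val (o k)) predT) //=.
  rewrite (eq_bigr (fun=> 1%N)) ?sum1_card // => d _.
  rewrite -[RHS](@card_conic_flag _ (o i) (o j) (o k) (v l) (v l') d).
    by rewrite -sum1_card; apply: eq_bigl => x; rewrite !inE andbA.
  by rewrite /= !inE !(inj_eq o_inj) negb_or ij eq_sym ki eq_sym kj.
- move=> h i j l l' l'' hi ij.
  rewrite -[RHS](@card_conic_flag _ (o h) (o i) (o j) (v l) (v l') (v l'')).
    by apply: eq_card => x; rewrite !inE andbA.
  rewrite /= !inE !(inj_eq o_inj) negb_or -!val_eqE /= !neq_ltn hi ij.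
  by rewrite (ltn_trans hi ij).
Qed.

Local Close Scope ring_scope.

Theorem theorem5p13 (q : nat) (F : finFieldType)
    (hq : is_prime_power q) (hF : #|F| = q) :
  (forall M : nat, exists n : nat, M < n /\ exists G : sgraph, is_TLS F q n G)
  /\
  (forall (n : nat) (G : sgraph), is_TLS F q n G ->
     [/\ exists mu : nat, co_edge_regular G mu,
         1 < n -> level G = 3
       & forall C : 'M['I_(q * n)]_(q.+1, (q * n) ^ 2), is_OA C ->
           cospectral G (clique_ext q (LS C))]).
Proof.
split=> [M|n G [O [S [n_gt0 OP SP ->]]]].
  have [n [Mn [O OP]]] := GOA_exists q M; have [S SP] := TLS_classes_exist hF.
  exists n; split=> //; exists (TLS O S), O, S.
  by split=> //; exact: leq_ltn_trans Mn.
have [c cP] := TLS_classes_fun hF SP; split.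
- exact: (TLS_co_edge_regular hF OP SP cP).
- exact: (TLS_level hF OP SP cP).
- by move=> C; exact: (TLS_cospectral hF OP SP cP n_gt0).
Qed.
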